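(* Fix an integer $d\ge 1$. There is a map $\tau=\tau_{L\bar c F}$ assigning to each $\Lambda_L$-formula $\phi(x_1,\dots,x_n)$ a $\Lambda_F^+$-formula $\tau(\phi)(X_1,\dots,X_n)$, where each $X_k$ is a $d\times d$-matrix of variables, such that the following hold. (a) $\tau(\phi)$ is quantifier free whenever $\phi$ is quantifier free. (b) For every $*$-field $F$, every $d$-dimensional inner product space $V$ over $F$ and every $\bar\alpha\in F^d$ admissible with respect to $V$: if $M\subseteq \mathsf L(V)^n$ is the relation defined in $\mathsf L(V)$ by $\phi(\bar x)$, then $\theta_{L\bar\alpha F}(M)\subseteq (F^{d\times d})^n$ is defined in $F$ by $\tau_{L\bar\alpha F}(\phi)(\bar X)$, that is, by $\tau(\phi)(\bar X)$ with the constants $c_1,\dots,c_d$ interpreted as $\alpha_1,\dots,\alpha_d$. (c) If, in addition, $\bar\alpha\in F_0^d$, where $F_0$ is the prime subfield of $F$, then the defining formula $\tau_{L\bar\alpha F}(\phi)(\bar X)$ can be taken in $\Lambda_F$ (and quantifier free if $\phi$ is).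
   Context: A $*$-field $F$ is a (commutative) field with an involution $r\mapsto r^*$ (possibly the identity); $F_0$ is its prime subfield. An inner product space $V$ over $F$ is a right $F$-vector space of finite dimension $d$ with a form $\langle\cdot|\cdot\rangle$ that is additive in both arguments and satisfies $\langle vr|ws\rangle=r^*\langle v|w\rangle s$, $\langle w|v\rangle=\langle v|w\rangle^*$, is non-degenerate, and has $\langle v|v\rangle\ne0$ for some $v$. Write $|v|=\langle v|v\rangle$. A $\perp$-basis is a basis $\bar v=(v_1,\dots,v_d)$ with $\langle v_i|v_j\rangle=0$ for $i\neq j$; for such a basis put $|\bar v|:=(1,|v_1|^{-1}|v_2|,\dots,|v_1|^{-1}|v_d|)$. A tuple $\bar\alpha=(\alpha_1,\dots,\alpha_d)\in F^d$ is admissible with respect to $V$ if $\alpha_1=1$, $\alpha_i=\alpha_i^*\ne0$ for all $i$, and $\bar\alpha=|\bar v|$ for some $\perp$-basis $\bar v$ of $V$. $\mathsf L(V)$ is the lattice of all linear subspaces of $V$ with join $+$, bottom $0$, and involution $U\mapsto U^\perp=\{x\in V\mid \langle x|u\rangle=0\ \forall u\in U\}$. Languages (first order): $\Lambda_L$ has signature $+,0,{}^\perp$ (with $s\cap t=(s^\perp+t^\perp)^\perp$ and $1=0^\perp$ as abbreviations); $\Lambda_F$ is the language of $*$-rings with constants $0,1$; $\Lambda_F^+$ is $\Lambda_F$ with additional constants $c_1,\dots,c_d$. A relation is defined by a formula if it consists exactly of the tuples satisfying it. For a basis $\bar v$ of $V$ and $A=(a_{ij})\in F^{d\times d}$, $\mathrm{Span}_{\bar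 v}(A)$ is the subspace spanned by the vectors $\sum_{i=1}^d v_ia_{ij}$, $j=1,\dots,d$. For $M\subseteq\mathsf L(V)^n$ put $\theta_{L\bar vF}(M)=\{(A_1,\dots,A_n)\in(F^{d\times d})^n\mid (\mathrm{Span}_{\bar v}(A_1),\dots,\mathrm{Span}_{\bar v}(A_n))\in M\}$, and let $\theta_{L\bar\alpha F}(M)$ be the union of the sets $\theta_{L\bar vF}(M)$ over all $\perp$-bases $\bar v$ of $V$ with $|\bar v|=\bar\alpha$. *)

(* Defs.v *)
From HB Require Import structures.
From mathcomp Require Import all_boot all_order all_algebra.

Set Implicit Arguments.
Unset Strict Implicit.
Unset Printing Implicit Defensive.

Import GRing.Theory.
Local Open Scope ring_scope.

(* First-order formulas with equality over a language without further         *)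
(* relation symbols; T X is the type of terms with variables in X, so         *)
(* formula T X is the type of formulas with free variables among X.           *)
(* Binders are well scoped: the bound variable is None : option X, and a free *)
(* variable x becomes Some x under the quantifier.                            *)
Inductive formula (T : Type -> Type) (X : Type) : Type :=
| FEq of T X & T X
| FNot of formula T X
| FAnd of formula T X & formula T X
| FOr of formula T X & formula T X
| FImp of formula T X & formula T X
| FForall of formula T (option X)
| FExists of formula T (option X).

Fixpoint qf (T : Type -> Type) (X : Type) (phi : formula T X) : bool :=
  match phi with
  | FEq _ _ => true
  | FNot f => qf f
  | FAnd f g | FOr f g | FImp f g => qf f && qf g
  | FForall _ | FExists _ => false
  end.

Fixpoint sat (T : Type -> Type) (D : Type)
    (eval : forall X : Type, (X -> D) -> T X -> D)
    (X : Type) (e : X -> D) (phi : formula T X) : Prop :=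
  match phi with
  | FEq s t => eval X e s = eval X e t
  | FNot f => ~ sat eval e f
  | FAnd f g => sat eval e f /\ sat eval e g
  | FOr f g => sat eval e f \/ sat eval e g
  | FImp f g => sat eval e f -> sat eval e g
  | FForall f => forall a : D, sat eval (oapp e a) f
  | FExists f => exists a : D, sat eval (oapp e a) f
  end.

(* Lattice terms; meet and top are the abbreviations (s^perp + t^perp)^perp   *)
(* and 0^perp.                                                                *)
Inductive lterm (X : Type) : Type :=
| LVar of X
| LZero
| LPlus of lterm X & lterm X
| LPerp of lterm X.

(* Terms of the language of *-rings with additional constants indexed by C;   *)
(* C = void gives the plain language, C = 'I_d the one with c_1, ..., c_d.    *)
Inductive rterm (C X : Type) : Type :=
| RVar of X
| RConst of C
| RZero
| ROne
| RAdd of rterm C X & rterm C X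
| ROpp of rterm C X
| RMul of rterm C X & rterm C X
| RStar of rterm C X.

Definition lformula : Type -> Type := formula lterm.
Definition rformula (C : Type) : Type -> Type := formula (rterm C).

(* free variables of a formula in n d x d-matrices of variables: (k, i, j)    *)
(* stands for entry (i, j) of the k-th matrix                                 *)
Definition mxvar (n d : nat) : Type := ('I_n * 'I_d * 'I_d)%type.

Section StarField.
Variables (F : fieldType) (star : involutive_rmorphism F).

Fixpoint reval (C : Type) (c : C -> F) (X : Type) (e : X -> F)
    (t : rterm C X) : F :=
  match t with
  | RVar x => e x
  | RConst k => c k
  | RZero => 0
  | ROne => 1
  | RAdd s t => reval c e s + reval c e t
  | ROpp s => - reval c e s
  | RMul s t => reval c e s * reval c e t
  | RStar s => star (reval c e s)
  end.

Definition mxenv (n d : nat) (A : n.-tuple 'M[F]_d) (x : mxvar n d) : F :=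
  tnth A x.1.1 x.1.2 x.2.

Definition field_defines (C : Type) (c : C -> F) (n d : nat)
    (psi : rformula C (mxvar n d)) (N : n.-tuple 'M[F]_d -> Prop) : Prop :=
  forall A : n.-tuple 'M[F]_d, N A <-> sat (@reval C c) (mxenv A) psi.

Definition in_prime_subfield (x : F) : Prop :=
  forall K : {pred F}, divring_closed K -> x \in K.

Section InnerProduct.
Variable (V : vectType F).

(* <v | w> is (form w v): hermitian forms of the library are linear in the    *)
(* first argument and star-semilinear in the second. Since F is commutative,  *)
(* scalars are written on the left.                                           *)
Variable (form : {hermitian_sym V for star}).

Definition inner_product : Prop :=
  nondegenerate form /\ exists v : V, form v v <> 0.

Fixpoint leval (X : Type) (e : X -> {vspace V}) (t : lterm X) : {vspace V} :=
  match t with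
  | LVar x => e x
  | LZero => 0%VS
  | LPlus s t => (leval e s + leval e t)%VS
  | LPerp s => orthov form (leval e s)
  end.

Definition lattice_defines (n : nat) (phi : lformula 'I_n)
    (M : n.-tuple {vspace V} -> Prop) : Prop :=
  forall U : n.-tuple {vspace V}, M U <-> sat leval (tnth U) phi.

Variable (d : nat).

Definition perp_basis (v : d.-tuple V) : Prop :=
  basis_of fullv v /\
  forall i j : 'I_d, i != j -> form (tnth v j) (tnth v i) = 0.

Definition basis_norm (v : d.-tuple V) : d.-tuple F :=
  [tuple if (i == 0 :> nat)%N then 1 else (form v`_0 v`_0)^-1 * form v`_i v`_i
   | i < d].

Definition admissible (alpha : d.-tuple F) : Prop :=
  [/\ alpha`_0 = 1,
      forall i : 'I_d, star (tnth alpha i) = tnth alpha i /\ tnth alpha i <> 0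
    & exists2 v : d.-tuple V, perp_basis v & alpha = basis_norm v].

Definition Span (v : d.-tuple V) (A : 'M[F]_d) : {vspace V} :=
  <<[tuple (\sum_(i < d) A i j *: tnth v i)%R | j < d]>>%VS.

Definition theta_basis (v : d.-tuple V) (n : nat)
    (M : n.-tuple {vspace V} -> Prop) (A : n.-tuple 'M[F]_d) : Prop :=
  M [tuple Span v (tnth A k) | k < n].

Definition theta (alpha : d.-tuple F) (n : nat)
    (M : n.-tuple {vspace V} -> Prop) (A : n.-tuple 'M[F]_d) : Prop :=
  exists v : d.-tuple V,
    [/\ perp_basis v, basis_norm v = alpha & theta_basis v M A].

End InnerProduct.
End StarField.

(* Main.v *)
Require Import Defs.
From mathcomp Require Import all_boot all_order all_algebra.
From mathcomp Require Import zify ring boolp.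

(** Fix a perp-basis [v] and code a subspace by coordinate vectors of
    generators; the form is then, up to a nonzero scalar, the one with Gram
    matrix [diag(alpha)], so the choice of [v] does not matter. Generators of
    [U^perp] are found without division by adding the generators [u] of [U] one
    at a time: if [L] generates [W] and some [<w|u>], [w] in [L], is nonzero,
    then [W] meets [u^perp] in the span of all [<w'|u> w - <w|u> w'] with
    [w, w'] in [L], and otherwise [W] lies in [u^perp]. So each lattice term has
    finitely many possible lists of generators, selected by quantifier-free
    conditions; inclusion is tested as orthogonality to the perp, by
    [W^perp perp = W], and a subspace quantifier becomes [d^2] field
    quantifiers. Only the ratios of the Gram entries matter, so over the prime
    field a common denominator turns them into closed integer terms. *)

Set Implicit Arguments.
Unset Strict Implicit.
Unset Printing Implicit Defensive.

Import GRing.Theory.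
Local Open Scope ring_scope.

(** * Blocks of quantifiers *)

Section BlockQuantifiers.
Variables (T : Type -> Type).

(** The options accumulate on [Y] rather than on the result, so that each recursion step passes the
    outermost of the [m] binders. *)
Fixpoint option_iter (m : nat) (Y : Type) : Type :=
  if m is m'.+1 then option_iter m' (option Y) else Y.

Fixpoint old_var (m : nat) : forall Y, Y -> option_iter m Y :=
  if m is m'.+1 then fun Y y => old_var m' (Some y) else fun Y y => y.

Fixpoint new_var (m : nat) : forall Y, 'I_m -> option_iter m Y :=
  if m is m'.+1 then fun Y i =>
    if unlift ord0 i is Some j then new_var (option Y) j
    else old_var m' (None : option Y)
  else fun Y i => False_rect _ (notF (ltn_ord i)).

Fixpoint forall_block (m : nat) : forall Y,
    formula T (option_iter m Y) -> formula T Y :=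
  if m is m'.+1 then fun Y f => FForall (@forall_block m' (option Y) f)
  else fun Y f => f.

Fixpoint exists_block (m : nat) : forall Y,
    formula T (option_iter m Y) -> formula T Y :=
  if m is m'.+1 then fun Y f => FExists (@exists_block m' (option Y) f)
  else fun Y f => f.

Variable D : Type.
Variable eval : forall X : Type, (X -> D) -> T X -> D.

(** Values are indexed by [nat], so that passing a binder is a plain shift; only those below [m] are
    read. *)
Fixpoint block_env (m : nat) : forall Y,
    (Y -> D) -> (nat -> D) -> option_iter m Y -> D :=
  if m is m'.+1 then fun Y e g =>
    @block_env m' (option Y) (oapp e (g 0)) (fun i => g i.+1)
  else fun Y e g => e.

Lemma block_env_old m Y (e : Y -> D) g y :
  block_env e g (old_var m y) = e y.
Proof. by elim: m Y e g y => //= m IHm Y e g y; rewrite IHm. Qed.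

Lemma block_env_new m Y (e : Y -> D) g (i : 'I_m) :
  block_env e g (new_var Y i) = g i.
Proof.
elim: m Y e g i => [|m IHm] Y e g i; first by case: i.
rewrite /=; case: unliftP => [j|] ->; first by rewrite IHm.
by rewrite block_env_old.
Qed.

(** A block of length 0 binds nothing; [a0] then provides an assignment [g] at which to
    instantiate. *)
Lemma sat_forall_block (a0 : D) m Y (e : Y -> D)
    (f : formula T (option_iter m Y)) :
  sat eval e (forall_block f) <-> forall g, sat eval (block_env e g) f.
Proof.
elim: m Y e f => [|m IHm] Y e f /=; first by split=> // /(_ (fun=> a0)).
split=> [fP g | fP a]; first exact: (proj1 (IHm _ _ _) (fP (g 0)) (g \o S)).
by apply/IHm => g; apply: (fP (fun i => if i is j.+1 then g j else a)).
Qed.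

Lemma sat_exists_block (a0 : D) m Y (e : Y -> D)
    (f : formula T (option_iter m Y)) :
  sat eval e (exists_block f) <-> exists g, sat eval (block_env e g) f.
Proof.
elim: m Y e f => [|m IHm] Y e f /=.
  by split=> [?|[]//]; exists (fun=> a0).
split=> [[a /IHm[g gP]] | [g gP]].
  by exists (fun i => if i is j.+1 then g j else a).
by exists (g 0); apply/IHm; exists (fun i => g i.+1).
Qed.

End BlockQuantifiers.

(** * Sums, integers and case distinctions in the field language *)

Section Terms.
Variables (C Y : Type).
Local Notation term := (rterm C Y).
Local Notation form := (rformula C Y).

Definition rsum (m : nat) (t : 'I_m -> term) : term :=
  \big[@RAdd C Y/RZero C Y]_(i < m) t i.

Definition rnat (m : nat) : term := iter m (RAdd (ROne C Y)) (RZero C Y).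

Definition rint (z : int) : term :=
  match z with Posz m => rnat m | Negz m => ROpp (rnat m.+1) end.

Definition all_zero (s : seq term) : form :=
  foldr (fun t => FAnd (FEq t (RZero C Y))) (FEq (RZero C Y) (RZero C Y)) s.

Definition ite (f g h : form) : form := FOr (FAnd f g) (FAnd (FNot f) h).

Lemma qf_all_zero s : qf (all_zero s).
Proof. by elim: s. Qed.

Lemma qf_ite f g h : qf f -> qf g -> qf h -> qf (ite f g h).
Proof. by rewrite /= => -> -> ->. Qed.

Variables (F : fieldType) (star : involutive_rmorphism F).
Variables (c : C -> F) (e : Y -> F).
Local Notation ev := (reval star c e).

Lemma reval_rsum m (t : 'I_m -> term) : ev (rsum t) = \sum_(i < m) ev (t i).
Proof. exact: (big_morph ev). Qed.

Lemma reval_rnat m : ev (rnat m) = m%:R.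
Proof. by elim: m => //= m ->; rewrite -[m.+1]add1n natrD. Qed.

Lemma reval_rint z : ev (rint z) = z%:~R.
Proof. by case: z => m; rewrite ?NegzE ?mulrNz -pmulrn -reval_rnat. Qed.

Lemma sat_all_zero s :
  sat (@reval F star C c) e (all_zero s) <-> all (fun t => ev t == 0) s.
Proof.
elim: s => [|t s IHs] //=.
by rewrite IHs; split=> [[-> ->]|/andP[/eqP]] //; rewrite eqxx.
Qed.

End Terms.

(** * Orthogonal complements of subspaces *)

Section Orthogonality.
Variables (F : fieldType) (star : involutive_rmorphism F) (V : vectType F).
Variable form : {hermitian_sym V for star}.
Implicit Types (U W : {vspace V}) (u w : V).

Lemma orthov_add U W :
  orthov form (U + W) = (orthov form U :&: orthov form W)%VS.
Proof.
apply/vspaceP => u.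
by rewrite memv_cap !memvE !(orthov_sym form <[u]>) subv_add.
Qed.

(** Each further generator costs the orthogonal at most one dimension. *)
Lemma dim_orthov_ge U : (\dim {:V} <= \dim U + \dim (orthov form U))%N.
Proof.
have IH (s : seq V) : (\dim {:V} <= size s + \dim (orthov form <<s>>))%N.
  elim: s => [|u s IHs]; first by rewrite span_nil orthov0.
  rewrite span_cons orthov_add capvC addSnnS (leq_trans IHs) // leq_add2l.
  by have := leq_dim_orthov1 form u (orthov form <<s>>); lia.
by have := IH (vbasis U); rewrite size_tuple (span_basis (vbasisP U)).
Qed.

(** A subspace lies in its double orthogonal, so equality of dimensions suffices. *)
Lemma orthovK U : nondegenerate form -> orthov form (orthov form U) = U.
Proof.
move=> /eqP form_nd.
have dimU W : (\dim W + \dim (orthov form W) = \dim {:V})%N.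
  apply/eqP; rewrite eqn_leq dim_orthov_ge andbT.
  (* By nondegeneracy the orthogonals of [W] and of its complement meet in 0, so their dimensions
     add up to at most that of [V]; the lower bound for the complement then gives the upper bound
     for [W]. *)
  have /dimvS : (orthov form W + orthov form W^C <= fullv)%VS by apply: subvf.
  rewrite dimv_disjoint_sum; last by rewrite -orthov_add addv_complf.
  have := dim_orthov_ge W^C%VS; rewrite dimv_compl.
  have := dimvS (subvf W); lia.
apply/esym/eqP; rewrite eqEdim orthov_sym subvv /=.
by rewrite -(leq_add2r (\dim (orthov form U))) addnC !dimU.
Qed.

(** If every pairing with [u] vanished, the listed vectors would all be 0 while the intersection is
    the whole span, hence the condition [has]. The factor [lam] is carried along because terms
    compute the form only up to a scalar. *)
Lemma span_cut (lam : F) (s : seq V) (u : V) :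
    lam != 0 -> has (fun w => form w u != 0) s ->
  <<[seq (lam * form w' u) *: w - (lam * form w u) *: w' | w' <- s, w <- s]>>%VS
    = (<<s>> :&: orthov form <[u]>)%VS.
Proof.
move=> lam0 /hasP[w1 sw1 w1u].
apply/eqP; rewrite eqEsubv subv_cap; apply/andP; split.
  apply/andP; split; apply/span_subvP => _ /allpairsP[[w' w] /= [sw' sw ->]].
    by rewrite rpredB ?rpredZ ?memv_span.
  rewrite mem_orthov1 linearBl !linearZl_LR /=.
  by rewrite mulrAC -mulrA subrr.
apply/subvP => x /memv_capP[].
rewrite mem_orthov1 => xs /eqP xu0.
have f1_neq0 : lam * form w1 u != 0 by rewrite mulf_neq0.
rewrite -(scalerK f1_neq0 x) rpredZ //.
rewrite -[s]in_tupleE in xs; have xE := coord_span xs.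
(* The subtracted multiple of [w1] is 0; expanding [x] in [s] distributes it over the summands, each
   of which becomes a multiple of a listed vector. *)
have -> : (lam * form w1 u) *: x =
    (lam * form w1 u) *: x - (lam * form x u) *: w1.
  by rewrite xu0 mulr0 scale0r subr0.
rewrite {}xE linear_sumlz /= mulr_sumr scaler_sumr scaler_suml.
rewrite -sumrB rpred_sum //= => i _.
set a := coord _ _ _; rewrite (_ : _ - _ =
    a *: ((lam * form w1 u) *: s`_i - (lam * form s`_i u) *: w1)).
  rewrite rpredZ // memv_span //; apply/allpairsP.
  by exists (w1, s`_i); rewrite mem_nth.
rewrite linearZl_LR /= scalerBr !scalerA; congr (_ *: _ - _ *: _); ring.
Qed.

End Orthogonality.

(** * The translation of formulas *)

Section Translation.
(** [gram] is given over every [Y] because the Gram entries recur under binders: constants serve for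
    (b), integer terms for (c). *)
Variables (d : nat) (C : Type) (gram : forall Y, 'I_d -> rterm C Y).

Section SubspaceTerms.
Variable Y : Type.
Local Notation vec := ('I_d -> rterm C Y).

Definition delta_vec (i : 'I_d) : vec :=
  fun j => if j == i then ROne C Y else RZero C Y.

Definition form_term (u w : vec) : rterm C Y :=
  rsum (fun i => RMul (gram Y i) (RMul (u i) (RStar (w i)))).

Definition cut (u : vec) (L : seq vec) : seq vec :=
  [seq (fun i => RAdd (RMul (form_term w' u) (w i))
                      (ROpp (RMul (form_term w u) (w' i)))) | w' <- L, w <- L].

(* Continuation-passing style: the quantifier-free case distinctions on the way
   to the list of generators wrap the formula [k] about that list. *)
Fixpoint perp_cps (s : seq vec) (k : seq vec -> rformula C Y) : rformula C Y :=
  if s is u :: s' then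
    perp_cps s' (fun L =>
      ite (all_zero [seq form_term w u | w <- L]) (k L) (k (cut u L)))
  else k [seq delta_vec i | i <- enum 'I_d].

Fixpoint lterm_cps X (rho : X * 'I_d * 'I_d -> Y) (t : lterm X)
    (k : seq vec -> rformula C Y) : rformula C Y :=
  match t with
  | LVar x => k [seq (fun i => RVar C (rho (x, i, j))) | j <- enum 'I_d]
  | LZero => k [::]
  | LPlus s t =>
      lterm_cps rho s (fun L => lterm_cps rho t (fun L' => k (L ++ L')))
  | LPerp s => lterm_cps rho s (fun L => perp_cps L k)
  end.

Definition subspace_formula (L L' : seq vec) : rformula C Y :=
  perp_cps L' (fun P => all_zero [seq form_term w p | w <- L, p <- P]).

Definition lequation X (rho : X * 'I_d * 'I_d -> Y) (s t : lterm X) :=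
  lterm_cps rho s (fun L => lterm_cps rho t (fun L' =>
    FAnd (subspace_formula L L') (subspace_formula L' L))).

Lemma qf_perp_cps s k : (forall L, qf (k L)) -> qf (perp_cps s k).
Proof.
elim: s k => [|u s IHs] k qf_k //=; apply: IHs => L.
by rewrite qf_ite ?qf_all_zero.
Qed.

Lemma qf_lterm_cps X (rho : X * 'I_d * 'I_d -> Y) t k :
  (forall L, qf (k L)) -> qf (lterm_cps rho t k).
Proof.
elim: t k => [x||s IHs t IHt|s IHs] k qf_k //=.
  by apply: IHs => L; apply: IHt.
by apply: IHs => L; apply: qf_perp_cps.
Qed.

Lemma qf_lequation X (rho : X * 'I_d * 'I_d -> Y) s t : qf (lequation rho s t).
Proof.
do 2!apply: qf_lterm_cps => ?.
by rewrite /= !qf_perp_cps // => ?; apply: qf_all_zero.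
Qed.

End SubspaceTerms.

Definition block_var X Y (rho : X * 'I_d * 'I_d -> Y)
    (p : option X * 'I_d * 'I_d) : option_iter (d * d) Y :=
  if p.1.1 is Some x then old_var (d * d) (rho (x, p.1.2, p.2))
  else new_var Y (mxvec_index p.1.2 p.2).

(** [rho] records which field variables hold the entries of each matrix; [Y] and [rho] vary along
    the recursion, as each subspace binder opens [d * d] field binders. *)
Fixpoint translate X (phi : lformula X) :
    forall Y, (X * 'I_d * 'I_d -> Y) -> rformula C Y :=
  match phi with
  | FEq s t => fun Y rho => lequation rho s t
  | FNot f => fun Y rho => FNot (translate f rho)
  | FAnd f g => fun Y rho => FAnd (translate f rho) (translate g rho)
  | FOr f g => fun Y rho => FOr (translate f rho) (translate g rho)
  | FImp f g => fun Y rho => FImp (translate f rho) (translate g rho)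
  | FForall f => fun Y rho =>
      forall_block (m := d * d) (translate f (block_var rho))
  | FExists f => fun Y rho =>
      exists_block (m := d * d) (translate f (block_var rho))
  end.

Lemma qf_translate X (phi : lformula X) Y (rho : X * 'I_d * 'I_d -> Y) :
  qf phi -> qf (translate phi rho).
Proof.
elim: phi Y rho => //= {X}.
- by move=> *; apply: qf_lequation.
- by move=> X f IHf g IHg Y rho /andP[/IHf-> /IHg->].
- by move=> X f IHf g IHg Y rho /andP[/IHf-> /IHg->].
- by move=> X f IHf g IHg Y rho /andP[/IHf-> /IHg->].
Qed.

(* [lam] is the factor left free by the choice of [a] as Gram entries; in part
   (c) it also absorbs the common denominator. *)
Section Semantics.
Variables (F : fieldType) (star : involutive_rmorphism F) (V : vectType F).
Variables (form : {hermitian_sym V for star}) (v : d.-tuple V) (c : C -> F).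
Variables (a : 'I_d -> F) (lam : F).
Hypotheses (form_nd : nondegenerate form) (v_basis : basis_of fullv v).
Hypothesis gramE : forall Y (e : Y -> F) i, reval star c e (gram Y i) = a i.
Hypothesis lam_neq0 : lam != 0.
Hypothesis form_basis : forall i j,
  form (tnth v i) (tnth v j) = if i == j then lam * a i else 0.

(** * Correctness for equations under a fixed assignment *)

Section Env.
Variables (Y : Type) (e : Y -> F).
Local Notation ev := (reval star c e).
Local Notation holds := (sat (@reval F star C c) e).
Local Notation vec := ('I_d -> rterm C Y).

Definition vec_val (u : vec) : V := \sum_(i < d) ev (u i) *: tnth v i.
Definition span_val (L : seq vec) : {vspace V} :=
  <<[seq vec_val u | u <- L]>>%VS.

Lemma reval_form_term u w :
  ev (form_term u w) = lam^-1 * form (vec_val u) (vec_val w).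
Proof.
rewrite reval_rsum linear_sumlz mulr_sumr; apply: eq_bigr => i _ /=.
rewrite linearZl_LR linear_sumr (bigD1 i) //= big1 => [|j ji].
  rewrite linearZr_LR /= form_basis eqxx addr0 gramE.
  by field.
by rewrite linearZr_LR /= form_basis eq_sym (negPf ji) mulr0.
Qed.

Lemma vec_val_cut u w w' :
  vec_val (fun i => RAdd (RMul (form_term w' u) (w i))
                      (ROpp (RMul (form_term w u) (w' i))))
  = (lam^-1 * form (vec_val w') (vec_val u)) *: vec_val w
    - (lam^-1 * form (vec_val w) (vec_val u)) *: vec_val w'.
Proof.
rewrite !scaler_sumr -sumrB; apply: eq_bigr => i _ /=.
by rewrite !reval_form_term scalerBl !scalerA.
Qed.

Lemma span_val_cut u (L : seq vec) :
    has (fun w => form (vec_val w) (vec_val u) != 0) L ->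
  span_val (cut u L) = (span_val L :&: orthov form <[vec_val u]>)%VS.
Proof.
move=> L_u; rewrite -(@span_cut _ _ _ _ lam^-1) ?invr_neq0 ?has_map //.
rewrite /span_val /cut map_allpairs allpairs_mapl allpairs_mapr.
congr (<<_>>%VS); apply: eq_allpairs => w' w /=; exact: vec_val_cut.
Qed.

Lemma span_val_delta : span_val [seq delta_vec Y i | i <- enum 'I_d] = fullv.
Proof.
rewrite -(span_basis v_basis) /span_val -map_comp; congr (<<_>>%VS).
rewrite -[RHS](map_tnth_enum v); apply: eq_map => i /=.
rewrite /vec_val /delta_vec (bigD1 i) //= big1 ?addr0 => [|j /negPf ji].
  by rewrite eqxx scale1r.
by rewrite ji scale0r.
Qed.

(** A fixed assignment decides every test, so a single list reaches the continuation. That [P] is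
    chosen before [k] lets the induction apply to the continuation that contains the next test. *)
Lemma perp_cpsP s : exists P, span_val P = orthov form (span_val s) /\
  forall k, holds (perp_cps s k) <-> holds (k P).
Proof.
elim: s => [|u s [P [PE holdsP]]].
  exists [seq delta_vec Y i | i <- enum 'I_d].
  by rewrite span_val_delta /span_val span_nil orthov0.
have sumE : span_val (u :: s) = (<[vec_val u]> + span_val s)%VS.
  by rewrite /span_val /= span_cons.
pose orth := all (fun w => form (vec_val w) (vec_val u) == 0) P.
have orthE : all (fun t => ev t == 0) [seq form_term w u | w <- P] = orth.
  rewrite all_map; apply: eq_all => w /=.
  by rewrite reval_form_term mulf_eq0 invr_eq0 (negPf lam_neq0).
exists (if orth then P else cut u P); split=> [|k].
  rewrite sumE orthov_add -PE capvC; case: ifP => [orth_P | /negbT].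
    apply/esym/capv_idPl; rewrite -span_seq1 -orthogonalE.
    by rewrite /orthogonal /ortho_rec all_map; under eq_all do rewrite /= andbT.
  by rewrite -has_predC; apply: span_val_cut.
rewrite holdsP /= sat_all_zero orthE; case: (orth).
  by split=> [[[]|[[]]] | ] //; left.
by split=> [[[]|[]] | ] //; right.
Qed.

Lemma lterm_cpsP X (rho : X * 'I_d * 'I_d -> Y) (E : X -> {vspace V}) t :
    (forall x, E x = Span v (\matrix_(i, j) e (rho (x, i, j)))) ->
  exists L, span_val L = leval form E t /\
  forall k, holds (lterm_cps rho t k) <-> holds (k L).
Proof.
move=> EE; elim: t => [x||s [L [LE LP]] t [L' [LE' LP']]|s [L [LE LP]]] /=.
- exists [seq (fun i => RVar C (rho (x, i, j))) | j <- enum 'I_d]; split=> //.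
  rewrite EE /Span /span_val -map_comp; congr (<<_>>%VS); apply: eq_map => j /=.
  by apply: eq_bigr => i _; rewrite mxE.
- by exists [::]; rewrite /span_val span_nil.
- exists (L ++ L'); rewrite -LE -LE' /span_val map_cat span_cat; split=> // k.
  by rewrite LP LP'.
- have [P [PE PP]] := perp_cpsP L.
  by exists P; rewrite PE LE; split=> // k; rewrite LP PP.
Qed.

Lemma subspace_formulaP L L' :
  holds (subspace_formula L L') <-> (span_val L <= span_val L')%VS.
Proof.
have [P [PE ->]] := perp_cpsP L'.
rewrite -[span_val L'](orthovK _ form_nd) -PE -orthogonalE sat_all_zero.
suff -> : all (fun t => ev t == 0) [seq form_term w p | w <- L, p <- P] =
    orthogonal form [seq vec_val w | w <- L] [seq vec_val p | p <- P] by [].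
rewrite /orthogonal /ortho_rec.
elim: L => //= w L IHL; rewrite all_cat IHL; congr (_ && _).
rewrite !all_map; apply: eq_all => p /=.
by rewrite reval_form_term mulf_eq0 invr_eq0 (negPf lam_neq0).
Qed.

Lemma lequationP X (rho : X * 'I_d * 'I_d -> Y) (E : X -> {vspace V}) s t :
    (forall x, E x = Span v (\matrix_(i, j) e (rho (x, i, j)))) ->
  holds (lequation rho s t) <-> leval form E s = leval form E t.
Proof.
move=> EE; have [L [<- LP]] := lterm_cpsP s EE.
have [L' [<- LP']] := lterm_cpsP t EE.
rewrite /lequation LP LP' /= !subspace_formulaP.
split=> [[sLL' sL'L] | ->]; last by rewrite subvv.
by apply/eqP; rewrite eqEsubv sLL'.
Qed.

End Env.

(** * Subspace quantifiers and correctness of the translation *)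

Definition block_entry (A : 'M[F]_d) (k : nat) : F :=
  if insub k is Some k' then mxvec A 0 k' else 0.

Lemma Span_surj (U : {vspace V}) : exists A, U = Span v A.
Proof.
(* Beyond [\dim U] the default value of [nth] is 0, which pads the basis of [U] to [d]
   generators. *)
pose u (j : 'I_d) := (vbasis U)`_j.
exists (\matrix_(i, j) coord v i (u j)).
rewrite /Span; set t := [tuple _ | _ < _].
have tE (j : 'I_d) : tnth t j = u j.
  rewrite tnth_mktuple; under eq_bigr do rewrite mxE (tnth_nth 0).
  by rewrite -(coord_basis v_basis) ?memvf.
have leUd : (\dim U <= d)%N.
  by rewrite -(size_basis v_basis); apply/dimvS/subvf.
apply/eqP; rewrite eqEsubv -{1}(span_basis (vbasisP U)).
apply/andP; split; apply/span_subvP => x.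
  move=> /(nthP 0)[k]; rewrite size_tuple => ltk <-.
  rewrite -[_`_k](tE (Ordinal (leq_trans ltk leUd))); apply/memv_span/mem_tnth.
move=> /tnthP[j ->]; rewrite tE /u; have [ltj | leUj] := ltnP j (\dim U).
  by rewrite vbasis_mem ?mem_nth ?size_tuple.
by rewrite nth_default ?mem0v ?size_tuple.
Qed.

Lemma block_varP X Y (rho : X * 'I_d * 'I_d -> Y) (e : Y -> F)
    (E : X -> {vspace V}) (g : nat -> F) :
    (forall x, E x = Span v (\matrix_(i, j) e (rho (x, i, j)))) ->
  forall x, oapp E (Span v (\matrix_(i, j) g (mxvec_index i j))) x =
    Span v (\matrix_(i, j) block_env e g (block_var rho (x, i, j))).
Proof.
move=> EE [x|] /=; rewrite ?EE; congr (Span v _).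
  all: apply/matrixP => i j; rewrite !mxE /=.
  by rewrite block_env_old.
by rewrite block_env_new.
Qed.

Lemma Span_block (U : {vspace V}) :
  exists g : nat -> F, U = Span v (\matrix_(i, j) g (mxvec_index i j)).
Proof.
(* An index from [mxvec_index] is always in range, so the default 0 of [block_entry] is never
   met. *)
have [A ->] := Span_surj U; exists (block_entry A); congr (Span v _).
by apply/matrixP => i j; rewrite mxE /block_entry valK mxvecE.
Qed.

(** By [Span_block] the assignments [g] of a block reach every subspace, and [block_varP] restores
    the hypothesis on [rho] under the binder. *)
Lemma translateP X (phi : lformula X) Y (rho : X * 'I_d * 'I_d -> Y)
    (e : Y -> F) (E : X -> {vspace V}) :
    (forall x, E x = Span v (\matrix_(i, j) e (rho (x, i, j)))) ->
  sat (leval form) E phi <-> sat (@reval F star C c) e (translate phi rho).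
Proof.
elim: phi Y rho e E => {X} /=.
- by move=> X s t Y rho e E EE; rewrite (lequationP _ _ EE).
- by move=> X f IHf Y rho e E EE; have := IHf Y rho e E EE; tauto.
- move=> X f IHf g IHg Y rho e E EE.
  by have := IHf Y rho e E EE; have := IHg Y rho e E EE; tauto.
- move=> X f IHf g IHg Y rho e E EE.
  by have := IHf Y rho e E EE; have := IHg Y rho e E EE; tauto.
- move=> X f IHf g IHg Y rho e E EE.
  by have := IHf Y rho e E EE; have := IHg Y rho e E EE; tauto.
- move=> X f IHf Y rho e E EE; rewrite (sat_forall_block _ 0).
  split=> [fP g | fP U].
    exact/(IHf _ _ (block_env e g) _ (block_varP g EE)).
  have [g ->] := Span_block U.
  by apply/(IHf _ _ (block_env e g) _ (block_varP g EE)).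
- move=> X f IHf Y rho e E EE; rewrite (sat_exists_block _ 0).
  split=> [[U fU] | [g /(IHf _ _ (block_env e g) _ (block_varP g EE)) fg]].
    2: by eexists; apply: fg.
  have [g Ug] := Span_block U; exists g.
  by apply/(IHf _ _ (block_env e g) _ (block_varP g EE)); rewrite -Ug.
Qed.

End Semantics.
End Translation.

(** * The prime subfield and the Gram entries of a perp-basis *)

Lemma prime_subfield_frac (F : fieldType) (x : F) : in_prime_subfield x ->
  exists p q : int, q%:~R != 0 :> F /\ x * q%:~R = p%:~R.
Proof.
(* The fractions form a subfield, hence contain the prime subfield. *)
pose frac (x : F) := exists p q : int, q%:~R != 0 :> F /\ x * q%:~R = p%:~R.
suff frac_closed : divring_closed [pred x | `[< frac x >]].
  by move=> /(_ _ frac_closed); rewrite inE => /asboolP.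
split=> [|{}x y|{}x y].
- by rewrite inE; apply/asboolP; exists 1, 1; rewrite oner_neq0 mulr1.
- rewrite !inE => /asboolP[p [q [q0 xE]]] /asboolP[p' [q' [q'0 yE]]].
  apply/asboolP; exists (p * q' - p' * q), (q * q').
  by rewrite rmorphB !rmorphM /= -xE -yE; split; [apply: mulf_neq0 | ring].
- rewrite !inE => /asboolP[p [q [q0 xE]]] /asboolP[p' [q' [q'0 yE]]].
  (* Division by 0 has the value 0, the fraction 0/1; otherwise [p'] is nonzero in [F] because it
     equals [y * q'] there. *)
  have [-> | y0] := eqVneq y 0.
    apply/asboolP; exists 0, 1; rewrite oner_neq0 invr0 mulr0 mul0r; split=> //.
  apply/asboolP; exists (p * q'), (q * p').
  by rewrite !rmorphM /= -xE -yE; split; [do !apply: mulf_neq0 | field].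
Qed.

Lemma common_denominator (F : fieldType) d (alpha : 'I_d -> F) :
  (forall i, in_prime_subfield (alpha i)) ->
  exists (a : 'I_d -> int) (N : int),
    N%:~R != 0 :> F /\ forall i, alpha i * N%:~R = (a i)%:~R.
Proof.
move=> alphaP; have /fin_all_exists[p /fin_all_exists[q pqP]] i :=
  prime_subfield_frac (alphaP i).
exists (fun i => p i * \prod_(j | j != i) q j), (\prod_j q j).
rewrite rmorph_prod; split=> [|i].
  by apply/prodf_neq0 => i _; case: (pqP i).
by rewrite (bigD1 i) //= rmorphM rmorph_prod /= mulrA (pqP i).2.
Qed.

(** Were the first basis vector isotropic, it would be orthogonal to the whole basis, hence 0 by
    nondegeneracy. So the normalization by its norm can be undone. *)
Lemma perp_basis_gram (F : fieldType) (star : involutive_rmorphism F)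
    (V : vectType F) (form : {hermitian_sym V for star}) d (v : d.-tuple V) :
  (0 < d)%N -> nondegenerate form -> perp_basis form v ->
  form v`_0 v`_0 != 0 /\
  forall i j, form (tnth v i) (tnth v j) =
    if i == j then form v`_0 v`_0 * tnth (basis_norm form v) i else 0.
Proof.
case: d v => // d v _ /eqP form_nd [v_basis v_perp].
have v0E : v`_0 = tnth v ord0 by rewrite (tnth_nth 0).
have form0 : form v`_0 v`_0 != 0.
  apply/eqP => form00.
  have : v`_0 \in orthov form fullv.
    rewrite -(span_basis v_basis) memvE -span_seq1 -orthogonalE.
    rewrite /orthogonal /ortho_rec /= andbT.
    apply/allP => _ /tnthP[i ->] /=; rewrite v0E.
    have [-> | i0] := eqVneq i ord0.
      by rewrite -v0E form00.
    by rewrite v_perp.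
  rewrite form_nd memv0 => /eqP v00.
  have : v`_0 != 0 by apply: (basis_not0 v_basis); rewrite mem_nth ?size_tuple.
  by rewrite v00 eqxx.
split=> // i j; case: eqP => [<- | /eqP ij]; last by rewrite v_perp // eq_sym.
rewrite tnth_mktuple; case: eqP => [i0 | _].
  2: by rewrite mulVKf // -tnth_nth.
by rewrite mulr1 (tnth_nth 0) i0.
Qed.

Theorem theorem6 (d : nat) (d_gt0 : (0 < d)%N) :
  exists tau : forall n : nat, lformula 'I_n -> rformula 'I_d (mxvar n d),
  [/\ (* (a) *)
      forall (n : nat) (phi : lformula 'I_n), qf phi -> qf (tau n phi),
      (* (b) *)
      forall (F : fieldType) (star : involutive_rmorphism F) (V : vectType F)
             (form : {hermitian_sym V for star}%R) (alpha : d.-tuple F),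
        inner_product form -> \dim (fullv : {vspace V}) = d ->
        admissible form alpha ->
        forall (n : nat) (phi : lformula 'I_n)
               (M : n.-tuple {vspace V} -> Prop),
          lattice_defines form phi M ->
          field_defines star (tnth alpha) (tau n phi) (theta form alpha M)
    & (* (c) *)
      forall (F : fieldType) (star : involutive_rmorphism F)
             (alpha : d.-tuple F),
        (forall i : 'I_d, in_prime_subfield (tnth alpha i)) ->
        forall (n : nat) (phi : lformula 'I_n),
        exists psi : rformula void (mxvar n d),
          (qf phi -> qf psi) /\
          forall (V : vectType F) (form : {hermitian_sym V for star}%R),
            inner_product form -> \dim (fullv : {vspace V}) = d ->
            admissible form alpha ->
            forall M : n.-tuple {vspace V} -> Prop,
              lattice_defines form phi M ->
              field_defines star (of_void F) psi (theta form alpha M)].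
Proof.
(* Parts (b) and (c) are instances of one claim, with the Gram terms evaluating to [alpha] times a
   nonzero [N]: 1 in (b), a common denominator in (c). *)
have defines C (gram : forall Y, 'I_d -> rterm C Y) (F : fieldType)
    (star : involutive_rmorphism F) (c : C -> F) (V : vectType F)
    (form : {hermitian_sym V for star}) (alpha : d.-tuple F) (N : F)
    (n : nat) (phi : lformula 'I_n) (M : n.-tuple {vspace V} -> Prop) :
    (forall Y (e : Y -> F) i, reval star c e (gram Y i) = tnth alpha i * N) ->
    N != 0 -> inner_product form -> admissible form alpha ->
    lattice_defines form phi M ->
  field_defines star c (translate gram phi id) (theta form alpha M).
  move=> gramE N0 [form_nd _] [_ _ [v0 v0_perp alphaE]] Mphi A.
  (* The right-hand side does not mention [v], so all perp-bases with norm tuple [alpha] give the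
     same set of matrices and the union in [theta] collapses. *)
  have basis_defines v : perp_basis form v -> basis_norm form v = alpha ->
      theta_basis v M A <->
      sat (@reval F star C c) (mxenv A) (translate gram phi id).
    move=> v_perp vE.
    have [form0 formE] := perp_basis_gram d_gt0 form_nd v_perp.
    (* This [lam] cancels [N]: the true Gram entries are [form v_0 v_0] times those of [alpha]. *)
    rewrite /theta_basis (Mphi _); pose lam := form v`_0 v`_0 / N.
    apply: (translateP (v := v) (lam := lam) form_nd _ gramE).
    - by case: v_perp.
    - by rewrite mulf_neq0 ?invr_neq0.
    - by move=> i j; rewrite /lam formE vE; case: eqP => // _; field.
    - move=> k; rewrite tnth_mktuple; congr (Span v _); apply/matrixP => i j.
      by rewrite mxE.
  split=> [[v [v_perp vE /basis_defines]] | ]; first exact.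
  (* Admissibility supplies the basis that the union needs. *)
  by move=> satA; exists v0; split=> //; apply/basis_defines.
exists (fun n phi => translate (fun Y i => RConst Y i) phi id); split.
- by move=> n phi; apply: qf_translate.
- move=> F star V form alpha form_ip _ adm n phi M Mphi.
  by apply: (defines _ _ _ _ _ _ _ _ 1) => // *; rewrite ?oner_neq0 ?mulr1.
(* The integers [a i] depend on [alpha] alone, so one formula serves every [V] and [form]. *)
move=> F star alpha /common_denominator[a [N [N0 aE]]] n phi.
exists (translate (fun Y i => rint void Y (a i)) phi id); split.
  exact: qf_translate.
move=> V form form_ip _ adm M Mphi.
by apply: (defines _ _ _ _ _ _ _ _ N%:~R) => // Y e i; rewrite reval_rint aE.
Qed.
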